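(* Let $X$ be a Piotrowski Tychonoff space. Then: (1) $X$ is Baire if and only if $X$ contains a dense metrizable Baire subspace; (2) $X$ is Choquet if and only if $X$ contains a dense completely metrizable subspace.
   Context: A topological space is Baire if the intersection of any sequence of its open dense subsets is dense. A function $f:Z\to X$ between topological spaces is quasicontinuous if for every $z\in Z$, every neighborhood $O_z$ of $z$ in $Z$ and every neighborhood $O_{f(z)}$ of $f(z)$ in $X$ there is a non-empty open set $U\subset O_z$ with $f(U)\subset O_{f(z)}$. A topological space $X$ is Piotrowski if every quasicontinuous map $f:Z\to X$ from a non-empty Baire space $Z$ has a continuity point. A topological space is completely metrizable if it is homeomorphic to a complete metric space. The Choquet game on a topological space $X$ is played by two players $\alpha$ and $\beta$ who alternately select non-empty open subsets of $X$. Player $\alpha$ starts with $U_0=X$; player $\beta$ answers with a non-empty open set $V_0\subset U_0$. At the $n$-th move $\alpha$ chooses a non-empty open set $U_n\subset V_{n-1}$ and $\beta$ answers with a non-empty open set $V_n\subset U_n$. Player $\alpha$ wins if $\bigcap_{n\in\omega}U_n\neq\emptyset$; otherwise $\beta$ wins. The space $X$ is Choquet if player $\alpha$ has a winning strategy in the Choquet game on $X$. *)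

(* Defs.v *)
From mathcomp Require Import all_boot all_order all_algebra.
From mathcomp Require Import all_classical all_reals all_analysis.

Set Implicit Arguments.
Unset Strict Implicit.
Unset Printing Implicit Defensive.

Local Open Scope classical_set_scope.

Definition baire_space (T : topologicalType) :=
  forall F : (set T)^nat,
    (forall n, open (F n) /\ dense (F n)) -> dense (\bigcap_n F n).

Definition quasicontinuous (Z X : topologicalType) (f : Z -> X) :=
  forall (z : Z) (O : set Z) (O' : set X), nbhs z O -> nbhs (f z) O' ->
    exists U : set Z, [/\ open U, U !=set0, U `<=` O & f @` U `<=` O'].

Definition piotrowski_space (X : topologicalType) :=
  forall (Z : topologicalType) (f : Z -> X),
    [set: Z] !=set0 -> baire_space Z -> quasicontinuous f ->
    exists z : Z, {for z, continuous f}.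

(* [completely_regular_space] carries no separation axiom. By
   [uniform_separatorP] it amounts to separating points from closed sets by
   continuous functions into [0, 1]. *)
Definition tychonoff_space (X : topologicalType) :=
  completely_regular_space X /\ hausdorff_space X.

Definition homeomorphic (X Y : topologicalType) :=
  exists (f : X -> Y) (g : Y -> X),
    [/\ cancel f g, cancel g f, continuous f & continuous g].

Definition metrizable_space (R : realType) (X : topologicalType) :=
  exists M : metricType R, homeomorphic X M.

(* The library's [completeType] is pointed, which would exclude the empty
   space; this is its completeness axiom without the base point. *)
Definition complete_uniform (M : uniformType) :=
  forall F : set_system M, ProperFilter F -> cauchy F -> exists p : M, F --> p.

Definition completely_metrizable_space (R : realType) (X : topologicalType) :=
  exists M : metricType R, complete_uniform M /\ homeomorphic X M.

Section ChoquetGame.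
Variable X : topologicalType.

(* A strategy of player alpha maps the moves V_0, ..., V_(n-1) made so far by
   beta to alpha's n-th move U_n. Alpha's own earlier moves are determined by
   the strategy. *)
Definition choquet_strategy := seq (set X) -> set X.

Implicit Types (s : choquet_strategy) (V : (set X)^nat).

Definition alpha_move s V (n : nat) : set X := s (mkseq V n).

Definition legal_beta s V (n : nat) :=
  [/\ open (V n), V n !=set0 & V n `<=` alpha_move s V n].

Definition legal_alpha s V (n : nat) :=
  [/\ open (alpha_move s V n.+1), alpha_move s V n.+1 !=set0
    & alpha_move s V n.+1 `<=` V n].

(* The opening move U_0 = X is imposed even on the empty space, where beta has
   no legal answer; the empty space is thus Choquet. *)
Definition winning_strategy s :=
  [/\ s [::] = setT,
      forall V n, (forall k, (k <= n)%N -> legal_beta s V k) ->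
        legal_alpha s V n
    & forall V, (forall n, legal_beta s V n) ->
        \bigcap_n alpha_move s V n !=set0].

Definition choquet_space := exists s, winning_strategy s.

End ChoquetGame.

(* Main.v *)
Require Import Defs.
From HB Require Import structures.
From mathcomp Require Import all_boot all_order all_algebra.
From mathcomp Require Import all_classical all_reals all_analysis.

Set Implicit Arguments.
Unset Strict Implicit.
Unset Printing Implicit Defensive.

Import Order.TTheory GRing.Theory Num.Theory.

Local Open Scope classical_set_scope.
Local Open Scope ring_scope.

(** The substance is to find a dense metrizable G_delta subset in a regular
    Hausdorff Piotrowski space [X] that is Baire.

    Fix a legal strategy of alpha in the Choquet game on [X], and call a play
    bad if the sets chosen by alpha have a common point without shrinking to
    it. Plays form a zero-dimensional metric space, in which two plays are close
    if they have a long beginning in common. The Piotrowski property implies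
    that the bad plays are meager in it ([piotrowski_avoidable_nil]): otherwise,
    by the Banach category theorem ([avoidable_nil]), the bad plays through some
    position form a non-empty Baire space, and sending a bad play to a point to
    which it does not shrink is a quasicontinuous map with no continuity point.

    So there are countably many dense open sets of plays whose intersection
    contains no bad play. Maximal families of positions with pairwise disjoint
    answers of alpha, each level extending the previous one and entering one
    more of these open sets, form a tree. On each level the answers cover a
    dense open set of [X]; let [D] be the intersection of these sets, dense if
    [X] is Baire. A point of [D] determines a branch, and as the answers along
    it shrink to the point, [D] is homeomorphic to a space of branches with the
    first-difference metric ([homeomorphic_branches]).

    If [X] is Baire, this is applied to the strategy that repeats beta's last
    move; the dense G_delta subset [D] of a Baire space is Baire. If [X] is
    Choquet, it is applied to a winning strategy: then all branches are
    inhabited, so that they form a closed, hence complete, space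
    ([complete_branches]). The converse implications hold in every regular
    space. *)

(** * Spaces of sequences with the first-difference metric *)

Definition agree (K : Type) (u v : nat -> K) (n : nat) :=
  forall i, (i < n)%N -> u i = v i.

Lemma agree_mkseq (K : Type) (u v : nat -> K) n :
  agree u v n <-> mkseq u n = mkseq v n.
Proof.
split=> [uv|uv i ilt].
  apply: (@eq_from_nth _ (u 0%N)) => [|i]; rewrite !size_mkseq // => ilt.
  by rewrite !nth_mkseq // uv.
have := congr1 (fun s => nth (u 0%N) s i) uv.
by rewrite !nth_mkseq.
Qed.

Section FirstDifference.
Variables (R : realType) (K : Type).
Implicit Types u v w : nat -> K.

Definition seq_dist u v : R :=
  if pselect (exists n, `[< u n <> v n >]) is left ex
  then (ex_minn ex).+1%:R^-1 else 0.

Lemma seq_dist0 u v : seq_dist u v = 0 -> u = v.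
Proof.
rewrite /seq_dist; case: pselect => [ex /eqP|nex _].
  by rewrite invr_eq0 pnatr_eq0.
apply/funext => n; apply: contrapT => uv; apply: nex.
by exists n; apply/asboolP.
Qed.

Lemma seq_distxx u : seq_dist u u = 0.
Proof.
rewrite /seq_dist; case: pselect => // ex.
by exfalso; case: ex => n /asboolP; apply.
Qed.

Lemma seq_dist_le u v n : seq_dist u v <= n.+1%:R^-1 <-> agree u v n.
Proof.
rewrite /seq_dist; case: pselect => [ex|nex].
  case: ex_minnP => m /asboolP dm minm; rewrite lef_pV2 ?posrE // ler_nat ltnS.
  split=> [nm i ilt|uv].
    apply: contrapT => /asboolP /minm.
    by rewrite leqNgt (leq_trans ilt).
  by rewrite leqNgt; apply/negP => /uv.
split=> [_ i _|_]; last by rewrite invr_ge0.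
by apply: contrapT => uv; apply: nex; exists i; apply/asboolP.
Qed.

Lemma seq_dist_sym u v : seq_dist u v = seq_dist v u.
Proof.
have le u' v' : seq_dist u' v' <= seq_dist v' u'.
  rewrite {2}/seq_dist; case: pselect => [ex|nex].
    apply/seq_dist_le => i; case: ex_minnP => m _ minm im.
    apply: contrapT => uv.
    have /minm : `[< v' i <> u' i >] by apply/asboolP => /esym.
    by rewrite leqNgt im.
  suff -> : u' = v' by rewrite seq_distxx.
  apply/funext => n; apply: contrapT => uv; apply: nex.
  by exists n; apply/asboolP => /esym.
by apply/eqP; rewrite eq_le !le.
Qed.

Lemma seq_distP u v :
  u = v \/ exists n, seq_dist u v = n.+1%:R^-1.
Proof.
case: (pselect (exists n, `[< u n <> v n >])) => [ex|nex].
  right; exists (ex_minn ex); rewrite /seq_dist; case: pselect => // ex'.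
  by rewrite (Prop_irrelevance ex ex').
left; apply/funext => n; apply: contrapT => uv; apply: nex.
by exists n; apply/asboolP.
Qed.

(** The strong inequality holds: if [u], [v] agree up to [m] and [v], [w] up to
    [n], then [u], [w] agree up to [minn m n]. *)
Lemma seq_dist_triangle v u w :
  seq_dist u w <= seq_dist u v + seq_dist v w.
Proof.
case: (seq_distP u v) => [->|[m duv]]; first by rewrite seq_distxx add0r.
case: (seq_distP v w) => [<-|[n dvw]]; first by rewrite seq_distxx addr0.
have uw : agree u w (minn m n).
  have /seq_dist_le uv : seq_dist u v <= m.+1%:R^-1 by rewrite duv.
  have /seq_dist_le vw : seq_dist v w <= n.+1%:R^-1 by rewrite dvw.
  by move=> i; rewrite ltn_min => /andP[im jm]; rewrite uv // vw.
move/seq_dist_le: uw => /le_trans; apply; rewrite duv dvw.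
by rewrite /minn; case: ltnP => _; rewrite ?lerDl ?lerDr invr_ge0.
Qed.

End FirstDifference.

(** The set [A] of sequences as a subspace of the product of countably many
    copies of the discrete space [K]. The parameter [R] only hosts the values
    of the distance. *)
Definition seq_space (R : realType) (K : Type) (A : set (nat -> K)) : Type :=
  {u : nat -> K | A u}.

Section SequenceSpace.
Variables (R : realType) (K : Type) (A : set (nat -> K)).
Local Notation Z := (seq_space R A).

HB.instance Definition _ := gen_eqMixin Z.
HB.instance Definition _ := gen_choiceMixin Z.

Let dist (x y : Z) : R := seq_dist R (sval x) (sval y).

Let distxx x : dist x x = 0. Proof. exact: seq_distxx. Qed.

Let dist_positivity x y : dist x y = 0 -> x = y.
Proof. by case: x y => [x Ax] [y Ay] /seq_dist0 /= xy; apply: eq_exist. Qed.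

Let dist_sym x y : dist x y = dist y x. Proof. exact: seq_dist_sym. Qed.

Let dist_triangle y x z : dist x z <= dist x y + dist y z.
Proof. exact: seq_dist_triangle. Qed.

HB.instance Definition _ :=
  isMetric.Build R Z distxx dist_positivity dist_sym dist_triangle.

Lemma ball_sub_cylinder (x : Z) n :
  ball x (n.+1%:R^-1 : R) `<=` [set y : Z | agree (sval x) (sval y) n].
Proof.
move=> y; rewrite ballEmdist /= => /ltW.
by move/(seq_dist_le R (sval x) (sval y) n).
Qed.

Lemma nbhs_seqP (x : Z) (O : set Z) :
  nbhs x O <-> exists n, forall y : Z, agree (sval x) (sval y) n -> O y.
Proof.
split.
  rewrite -nbhs_ballE => -[e /= e0 xO].
  pose n := Num.bound e^-1; exists n => y xy; apply: xO.
  rewrite ballEmdist /=; apply: (@le_lt_trans _ _ n.+1%:R^-1).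
    exact/seq_dist_le.
  rewrite invf_plt ?posrE //.
  apply: lt_trans (archi_boundP _) _; first by rewrite invr_ge0 ltW.
  by rewrite ltr_nat.
move=> [n xO]; rewrite -nbhs_ballE; exists n.+1%:R^-1 => /=.
  by rewrite invr_gt0.
by move=> y /ball_sub_cylinder /xO.
Qed.

(** The hypothesis says that [A] is closed. A Cauchy filter decides each entry
    of the sequence, and so determines the limit [u] entry by entry. *)
Lemma complete_seq_space :
  (forall u, (forall n, exists2 v, A v & agree u v n) -> A u) ->
  complete_uniform Z.
Proof.
move=> clA F PF cF.
have /choice[c Fc] n : exists c : Z, F [set y | agree (sval c) (sval y) n].
  have [|c Fc] := (cauchyP F).1 cF n.+1%:R^-1; first by rewrite invr_gt0.
  by exists c; apply: filterS Fc; apply: ball_sub_cylinder.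
pose u n := sval (c n.+1) n.
have uc n : agree u (sval (c n)) n.
  move=> i ilt; have [y [iy ny]] := filter_ex (filterI (Fc i.+1) (Fc n)).
  by rewrite /u iy // ny.
have Au : A u by apply: clA => n; exists (sval (c n)); [exact: (svalP (c n))|].
exists (exist _ u Au) => O /nbhs_seqP[n uO].
by apply: filterS (Fc n) => y cy; apply: uO => i ilt; rewrite -cy //; apply: uc.
Qed.

End SequenceSpace.

Lemma take_mkseq (K : Type) (u : nat -> K) m n :
  (m <= n)%N -> take m (mkseq u n) = mkseq u m.
Proof. by move=> mn; rewrite /mkseq -map_take take_iota (minn_idPl mn). Qed.

Lemma prefix_mkseq (K : eqType) (u : nat -> K) (h : seq K) n :
  prefix h (mkseq u n) -> mkseq u (size h) = h.
Proof.
move=> hu; have hn : (size h <= n)%N.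
  by rewrite -(size_mkseq u n); apply: size_prefix.
by rewrite -(take_mkseq u hn); apply/eqP; rewrite -prefixE.
Qed.

Lemma mkseq_prefix (K : eqType) (u : nat -> K) m n :
  (m <= n)%N -> prefix (mkseq u m) (mkseq u n).
Proof. by move=> mn; rewrite prefixE size_mkseq take_mkseq. Qed.

Lemma agree_prefix (K : Type) (u v : nat -> K) m n :
  (m <= n)%N -> mkseq u n = mkseq v n -> agree u v m.
Proof.
by move=> mn /agree_mkseq uv i im; apply: uv; apply: leq_trans im mn.
Qed.

Lemma prefix_agree (K : eqType) (u v : nat -> K) m n k :
  (m <= n)%N -> prefix (mkseq u n) (mkseq v k) -> agree u v m.
Proof.
move=> mn /prefix_mkseq; rewrite size_mkseq => /esym; exact: agree_prefix.
Qed.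

(** * Positions of the Choquet game *)

Section Game.
Variables (X : topologicalType) (s : choquet_strategy X).
Implicit Types (h t : seq (set X)) (u : nat -> set X) (O : set X).

(** A strategy that answers every legal move legally, whether or not it wins:
    part (1) of the theorem runs on such a strategy, part (2) on a winning
    one. *)
Definition legal_strategy :=
  s [::] = setT /\
  forall V n, (forall k, (k <= n)%N -> legal_beta s V k) -> legal_alpha s V n.

(** A position is the sequence of the moves beta has made. The default [set0]
    of [nth] is never read. *)
Definition legal h :=
  forall k, (k < size h)%N -> legal_beta s (nth set0 h) k.

Lemma alpha_move_nth h k : (k <= size h)%N ->
  alpha_move s (nth set0 h) k = s (take k h).
Proof.
move=> kh; rewrite /alpha_move -(take_mkseq _ kh).
by rewrite /mkseq map_nth_iota0 // take_size.
Qed.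

Lemma legal_nil : legal [::]. Proof. by []. Qed.

Lemma legal_rconsP h V :
  legal (rcons h V) <-> [/\ legal h, open V, V !=set0 & V `<=` s h].
Proof.
have old k : (k < size h)%N ->
    legal_beta s (nth set0 (rcons h V)) k <-> legal_beta s (nth set0 h) k.
  move=> kh; rewrite /legal_beta !alpha_move_nth ?size_rcons ?(ltnW kh) //.
    by rewrite nth_rcons kh -cats1 take_cat kh.
  exact: ltnW (ltnW _).
have new : legal_beta s (nth set0 (rcons h V)) (size h) <->
    [/\ open V, V !=set0 & V `<=` s h].
  rewrite /legal_beta alpha_move_nth ?size_rcons // nth_rcons ltnn eqxx.
  by rewrite -cats1 take_size_cat.
split=> [lhV|[lh oV V0 Vs] k].
  have [|oV V0 Vs] := new.1; first by apply: lhV; rewrite size_rcons.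
  by split => // k kh; apply/old => //; apply: lhV; rewrite size_rcons ltnW.
rewrite size_rcons ltnS leq_eqVlt => /orP[/eqP ->|kh]; first exact/new.
by apply/old => //; apply: lh.
Qed.

Lemma legal_prefix h t : prefix h t -> legal t -> legal h.
Proof.
move=> /prefixP[r ->{t}]; elim/last_ind: r => [|r V IHr]; rewrite ?cats0 //.
by rewrite -rcons_cat => /legal_rconsP[/IHr].
Qed.

Lemma legal_playP u :
  (forall n, legal (mkseq u n)) <-> (forall n, legal_beta s u n).
Proof.
split=> [lu n|lu n].
  by have := lu n.+1; rewrite mkseqS => /legal_rconsP[].
elim: n => [|n IHn]; first exact: legal_nil.
by rewrite mkseqS; apply/legal_rconsP; have [] := lu n.
Qed.

Hypothesis ls : legal_strategy.

Lemma legal_answer h V : legal (rcons h V) ->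
  [/\ open (s (rcons h V)), s (rcons h V) !=set0 & s (rcons h V) `<=` V].
Proof.
move=> lhV; have [|] := ls.2 (nth set0 (rcons h V)) (size h).
  by move=> k kh; apply: lhV; rewrite size_rcons ltnS.
rewrite alpha_move_nth ?size_rcons // nth_rcons ltnn eqxx.
by rewrite -(size_rcons h V) take_size.
Qed.

Lemma legal_open h : legal h -> open (s h).
Proof.
case/lastP: h => [|h V /legal_answer[]//]; rewrite ls.1 => _; exact: openT.
Qed.

Lemma legal_sub h t : prefix h t -> legal t -> s t `<=` s h.
Proof.
move=> /prefixP[r ->{t}].
elim/last_ind: r => [|r V IHr]; first by rewrite cats0 => _ x.
rewrite -rcons_cat => lt; have [lhr _ _ Vs] := (legal_rconsP _ _).1 lt.
have [_ _ sV] := legal_answer lt.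
exact: subset_trans (subset_trans sV Vs) (IHr lhr).
Qed.

(** * Bad plays and the Banach category argument *)

Definition local_base u (x : X) :=
  forall O, nbhs x O -> exists n, s (mkseq u n) `<=` O.

(** The plays to be avoided: the sets chosen by alpha share a point but do not
    shrink to it. *)
Definition bad_play u :=
  (forall n, legal (mkseq u n)) /\
  exists2 x, (forall n, s (mkseq u n) x) & ~ local_base u x.

(** In the space of plays, the sets of the plays that meet [W k] are open and,
    on the cylinder of [h], dense, and their intersection contains no bad
    play. That such a [W] exists says that the bad plays form a meager subset
    of the cylinder of [h]. *)
Definition avoids (W : nat -> set (seq (set X))) h :=
  (forall k t, prefix h t -> legal t ->
     exists2 t', prefix t t' & legal t' /\ W k t') /\
  (forall u, bad_play u -> mkseq u (size h) = h ->
     ~ forall k, exists n, W k (mkseq u n)).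

Definition avoidable h := exists W, avoids W h.

(** The Banach category theorem: a set that is meager in densely many cylinders
    is meager. The shortest positions with a meager cylinder are pairwise
    incompatible, so the witnesses [W g] at these positions [g] can be glued
    without interfering: a play passes through at most one of them. *)
Lemma avoidable_nil :
  (forall h, legal h -> exists2 h', prefix h h' & legal h' /\ avoidable h') ->
  avoidable [::].
Proof.
move=> dense_avoidable.
have /choice[W Wh] h : exists W, avoidable h -> avoids W h.
  by have [[W ?]|nh] := pselect (avoidable h); [exists W|exists (fun=> setT)].
pose least g :=
  avoidable g /\ forall m, (m < size g)%N -> ~ avoidable (take m g).
exists (fun k => [set t | exists g, [/\ least g, prefix g t & W g k t]]).
split=> [k t _ lt|u bu _ hits].
  have [h' tt' [lt' gt']] := dense_avoidable t lt.
  have ex : exists m, `[< avoidable (take m h') >].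
    by exists (size h'); apply/asboolP; rewrite take_size.
  case: (ex_minnP ex) => m /asboolP gm minm; set g := take m h' in gm.
  have gh' : prefix g h' by apply: prefix_take.
  have [h'' h'h'' [lh'' Wh'']] := (Wh g gm).1 k h' gh' lt'.
  exists h''; first exact: prefix_trans tt' h'h''.
  split=> //; exists g; split => //; last exact: prefix_trans gh' h'h''.
  split=> // i ig; rewrite /g take_takel; last first.
    by rewrite (leq_trans (ltnW ig)) // size_take_min geq_minl.
  move=> /asboolP /minm; rewrite leqNgt (leq_trans ig) //.
  by rewrite size_take_min geq_minl.
(* whichever k is used, the same shortest position g is found along u *)
have [n0 [g [[gg ming] /prefix_mkseq gu _]]] := hits 0%N.
apply: ((Wh g gg).2 u bu gu) => k.
have [n [g' [[gg' ming'] /prefix_mkseq gu' Wn]]] := hits k.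
suff gg'E : g = g' by exists n; rewrite gg'E.
case: (ltngtP (size g) (size g')) => [lt|lt|eqs]; last by rewrite -gu -gu' eqs.
  by case: (ming' _ lt); rewrite -gu' take_mkseq ?(ltnW lt) // gu.
by case: (ming _ lt); rewrite -gu take_mkseq ?(ltnW lt) // gu'.
Qed.

End Game.

Section PiotrowskiGame.
Variables (R : realType) (X : topologicalType) (s : choquet_strategy X).
Hypotheses (ls : legal_strategy s) (pX : piotrowski_space X).
Hypothesis regX : @regular_space X.

(** If the bad plays were not meager, they would be nowhere meager below some
    position [h0], so that the space [Z] of bad plays through [h0] would be
    Baire. Let [f] send a bad play to a point to which it fails to shrink. In
    any position beta may move into any open set met by alpha's last move,
    hence [f] is quasicontinuous. At a continuity point [z] alpha's moves would
    have to shrink to [f z]: otherwise beta moves outside a closed neighborhood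
    of [f z], and bad plays close to [z] have values far from [f z]. *)
Lemma piotrowski_avoidable_nil : avoidable s [::].
Proof.
apply: avoidable_nil; apply: contrapT => /existsNP[h0 /not_implyP[lh0 none]].
have unavoidable h : prefix h0 h -> legal s h -> ~ avoidable s h.
  by move=> h0h lh gh; apply: none; exists h.
pose A := [set u | bad_play s u /\ mkseq u (size h0) = h0].
pose Z := seq_space R A.
have /choice[f fP] (z : Z) : exists x, (forall n, s (mkseq (sval z) n) x) /\
    ~ local_base s (sval z) x.
  by case: z => u /= [[_ [x ? ?]] _]; exists x.
have Zlegal (z : Z) n : legal s (mkseq (sval z) n).
  by case: z => u /= [[]].
have Zh0 (z : Z) n : (size h0 <= n)%N -> prefix h0 (mkseq (sval z) n).
  case: z => u /= [_ uh0] hn; rewrite -{1}uh0; exact: mkseq_prefix.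
have bad_through h u : prefix h0 h -> bad_play s u ->
    mkseq u (size h) = h -> A u.
  move=> h0h bu uh; split=> //; rewrite -uh in h0h.
  exact: prefix_mkseq h0h.
have meets h : prefix h0 h -> legal s h ->
    exists z : Z, mkseq (sval z) (size h) = h.
  move=> h0h lh; apply: contrapT => noz; apply: (unavoidable h) => //.
  exists (fun=> setT); split=> [k t _ lt|u bu uh _].
    by exists t => //; apply: prefix_refl.
  by apply: noz; exists (exist _ u (bad_through _ _ h0h bu uh)).
have cyl_open h : open [set z : Z | mkseq (sval z) (size h) = h].
  rewrite openE => z /= zh; apply/nbhs_seqP; exists (size h) => y.
  by rewrite /= -[in X in _ = X]zh => /agree_mkseq.
have [z0 _] := meets _ (prefix_refl h0) lh0.
have baireZ : baire_space Z.
  move=> F oF O [z Oz] oO; apply: contrapT => empty.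
  have [n zO] : exists n, forall y : Z, agree (sval z) (sval y) n -> O y.
    by apply/nbhs_seqP; apply: open_nbhs_nbhs.
  pose m := maxn n (size h0); pose t := mkseq (sval z) m.
  have h0t : prefix h0 t by apply: Zh0; rewrite leq_maxr.
  apply: (unavoidable t) => //; first exact: Zlegal.
  (* otherwise the dense open sets F k witness that t is avoidable *)
  exists (fun k => [set t' | forall y : Z,
    mkseq (sval y) (size t') = t' -> F k y]).
  split=> [k t' tt' lt'|u bu ut hits].
    have h0t' := prefix_trans h0t tt'.
    have [z' z't'] := meets _ h0t' lt'.
    have [y [yt' Fy]] := (oF k).2 _ (ex_intro _ z' z't') (cyl_open t').
    have [n' yF] : exists n', forall w : Z, agree (sval y) (sval w) n' -> F k w.
      by apply/nbhs_seqP; apply: open_nbhs_nbhs; split => //; case: (oF k).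
    exists (mkseq (sval y) (maxn n' (size t'))).
      by rewrite -{1}yt'; apply: mkseq_prefix; rewrite leq_maxr.
    split=> // w; rewrite size_mkseq => wy; apply: yF.
    by apply: (agree_prefix (leq_maxl n' (size t'))).
  pose zu : Z := exist _ u (bad_through _ _ h0t bu ut).
  apply: empty; exists zu; split.
    apply: zO; apply: (agree_prefix (leq_maxl n (size h0))).
    by rewrite -/m -/t -[in LHS]ut size_mkseq.
  move=> k _; have [i Wi] := hits k; apply: Wi.
  by rewrite size_mkseq.
(* beta continues the play z, from its n-th position on, inside V *)
have step (z : Z) n V : open V -> (s (mkseq (sval z) n) `&` V) !=set0 ->
    (size h0 <= n)%N ->
    exists h, [/\ h = rcons (mkseq (sval z) n) (s (mkseq (sval z) n) `&` V),
      prefix h0 h, legal s h & s h `<=` V].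
  move=> oV V0 hn; eexists; split; first by [].
  - exact: prefix_trans (Zh0 z n hn) (prefix_rcons _ _).
  - by apply/legal_rconsP; split => //; apply: openI => //; apply: legal_open.
  - have [|_ _] := @legal_answer _ _ ls (mkseq (sval z) n)
      (s (mkseq (sval z) n) `&` V).
      by apply/legal_rconsP; split => //; apply: openI => //; apply: legal_open.
    by move/subset_trans; apply; apply: subIsetr.
have quasif : quasicontinuous f.
  move=> z O O' /nbhs_seqP[n zO]; rewrite nbhsE => -[V [oV Vfz] VO'].
  pose m := maxn n (size h0).
  have [|h [hE h0h lh sV]] := step z m V oV _ (leq_maxr _ _).
    by exists (f z); split => //; apply: (fP z).1.
  exists [set y : Z | mkseq (sval y) (size h) = h]; split => //.
  - exact: meets.
  - move=> y yh; apply: zO.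
    apply: (@prefix_agree _ _ _ _ m (size h)); rewrite ?leq_maxl //.
    by rewrite yh hE prefix_rcons.
  - by move=> _ [y yh <-]; apply/VO'/sV; rewrite -yh; apply: (fP y).1.
have [z cz] := pX (ex_intro _ z0 Logic.I) baireZ quasif.
apply: (fP z).2 => O /regX [N nN NO].
have [n zN] : exists n, forall y : Z, agree (sval z) (sval y) n -> N (f y).
  by apply/nbhs_seqP; apply: cz.
pose m := maxn n (size h0); exists m => y sy; apply: contrapT => nOy.
have [||| h [hE h0h lh sV]] := step z m (~` closure N).
- by apply: closed_openC; apply: closed_closure.
- by exists y; split => // /NO.
- exact: leq_maxr.
have [w wh] := meets h h0h lh.
have : (~` closure N) (f w) by apply: sV; rewrite -wh; apply: (fP w).1.
apply; apply: subset_closure; apply: zN.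
apply: (@prefix_agree _ _ _ _ m (size h)); rewrite ?leq_maxl //.
by rewrite wh hE prefix_rcons.
Qed.

End PiotrowskiGame.

(** * The tree of positions and its branches *)

Section Tree.
Variables (X : topologicalType) (s : choquet_strategy X).
Variable W : nat -> set (seq (set X)).
Hypotheses (ls : legal_strategy s) (avW : avoids s W [::]).
Implicit Types (h : seq (set X)) (p : nat -> seq (set X)) (V O : set X).

(** The strict inequality makes the positions along a branch of the tree grow
    to an infinite play. *)
Definition long_ext (k : nat) h : set (seq (set X)) :=
  [set h' | [/\ legal s h', prefix h h', (size h < size h')%N & W k h']].

Lemma long_ext_dense k h V : legal s h -> open V -> (s h `&` V) !=set0 ->
  exists2 h', long_ext k h h' & s h' `<=` V.
Proof.
move=> lh oV sV0.
have lhV : legal s (rcons h (s h `&` V)).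
  apply/legal_rconsP; split => //.
  by apply: openI => //; apply: legal_open.
have [h' hh' [lh' Wh']] := avW.1 k _ (prefix0s _) lhV.
exists h'.
  split=> //; first exact: prefix_trans (prefix_rcons _ _) hh'.
  by have := size_prefix hh'; rewrite size_rcons.
have [_ _ sub] := legal_answer ls lhV.
apply: subset_trans (legal_sub ls hh' lh') _.
exact: subset_trans sub (@subIsetr _ _ _).
Qed.

Definition children (k : nat) h : set (seq (set X)) :=
  sval (ex_maximal_disjoint_subcollection s (long_ext k h)).

Lemma childrenP k h :
  maximal_disjoint_subcollection s (children k h) (long_ext k h).
Proof. exact: (svalP (ex_maximal_disjoint_subcollection s (long_ext k h))). Qed.

Lemma children_ext k h h' : children k h h' -> long_ext k h h'.
Proof. by have [sub _ _] := childrenP k h; apply: sub. Qed.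

(** Since the family of children is maximal, an extension whose answer lies
    inside [V] cannot be disjoint from all the answers to the children. *)
Lemma children_dense k h V : legal s h -> open V -> (s h `&` V) !=set0 ->
  exists2 h', children k h h' & (s h' `&` V) !=set0.
Proof.
move=> lh oV sV0; apply: contrapT => none.
have [h' eh' sh'] := long_ext_dense k lh oV sV0.
have disj g : children k h g -> ~ ((s g `&` s h') !=set0).
  move=> cg [x [gx hx]]; apply: none; exists g => //.
  by exists x; split => //; apply: sh'.
have h'0 : s h' !=set0.
  case: eh' => + _ + _; case/lastP: h' {sh' disj} => // h' U lU _.
  by have [] := legal_answer ls lU.
have nh' : ~ children k h h'.
  by move=> ch'; apply: (disj _ ch'); rewrite setIid.
have [sub triv maxC] := childrenP k h.
apply: (maxC (children k h `|` [set h'])).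
- split; first exact: subsetUl.
  by move=> /(_ h' (or_intror erefl)).
- by move=> g [/sub|->].
- move=> g g' [cg|->] [cg'|->] gg' => //.
  + exact: triv.
  + by case: (disj g).
  + by case: (disj g') => //; rewrite setIC.
Qed.

Fixpoint level (k : nat) : set (seq (set X)) :=
  if k is k'.+1 then [set h' | exists2 h, level k' h & children k' h h']
  else [set [::]].

Lemma level_legal k h : level k h -> legal s h.
Proof.
case: k => [->|k [g _ /children_ext[]//]]; exact: legal_nil.
Qed.

Lemma level_disjoint k h h' x :
  level k h -> level k h' -> s h x -> s h' x -> h = h'.
Proof.
elim: k h h' => [|k IHk] h h' /=; first by move=> -> ->.
move=> [g lg cgh] [g' lg' cgh'] hx h'x.
have gg' : g = g'.
  have [lh gh _ _] := children_ext cgh; have [lh' gh' _ _] := children_ext cgh'.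
  apply: IHk => //; first exact: (legal_sub ls gh lh).
  exact: (legal_sub ls gh' lh').
subst g'; have [_ triv _] := childrenP k g.
by apply: triv => //; exists x.
Qed.

Definition level_cover (k : nat) : set X := \bigcup_(h in level k) s h.

Lemma level_cover_open k : open (level_cover k).
Proof. by apply: bigcup_open => h /level_legal; apply: legal_open. Qed.

Lemma level_cover_dense k : dense (level_cover k).
Proof.
elim: k => [|k IHk] O O0 oO.
  by case: O0 => x Ox; exists x; split => //; exists [::] => //; rewrite ls.1.
have [x [Ox [h lh hx]]] := IHk O O0 oO.
have [||h' ch' [y [h'y Oy]]] := @children_dense k h O (level_legal lh) => //.
  by exists x.
by exists y; split => //; exists h' => //; exists h.
Qed.

Definition branch p := p 0%N = [::] /\ forall k, children k (p k) (p k.+1).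

Lemma branch_level p k : branch p -> level k (p k).
Proof. by move=> [p0 cp]; elim: k => //= k IHk; exists (p k). Qed.

Lemma branch_prefix p j k : branch p -> (j <= k)%N -> prefix (p j) (p k).
Proof.
move=> [_ cp]; elim: k => [|k IHk].
  by rewrite leqn0 => /eqP ->; exact: prefix_refl.
rewrite leq_eqVlt => /orP[/eqP ->|]; first exact: prefix_refl.
rewrite ltnS => /IHk /prefix_trans; apply.
by have [] := children_ext (cp k).
Qed.

Lemma branch_play p : branch p -> exists u : nat -> set X,
  [/\ forall k, mkseq u (size (p k)) = p k,
      forall n, prefix (mkseq u n) (p n) & forall n, legal s (mkseq u n)].
Proof.
move=> bp; have [_ cp] := bp.
have szp k : (k <= size (p k))%N.
  elim: k => // k IHk; have [_ _ + _] := children_ext (cp k).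
  exact: leq_ltn_trans.
pose u n := nth set0 (p n.+1) n.
have nthp j k i : (j <= k)%N -> (i < size (p j))%N ->
    nth set0 (p k) i = nth set0 (p j) i.
  move=> jk ij; have /prefixP[r ->] := branch_prefix bp jk.
  by rewrite nth_cat ij.
have up k : mkseq u (size (p k)) = p k.
  apply: (@eq_from_nth _ set0) => [|i]; rewrite size_mkseq // => ik.
  rewrite nth_mkseq // /u; case: (leqP i.+1 k) => [lek|/ltnW lek].
    by apply/esym/nthp => //; apply: szp.
  exact: nthp.
exists u; split => // n.
  by rewrite -(up n); apply: mkseq_prefix.
apply: (@legal_prefix _ _ _ (p n)).
  by rewrite -(up n); apply: mkseq_prefix.
exact: level_legal (branch_level n bp).
Qed.

(** The play along a branch meets every [W k], so it is not bad. *)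
Lemma branch_local_base p x O : branch p -> (forall k, s (p k) x) ->
  nbhs x O -> exists k, s (p k) `<=` O.
Proof.
move=> bp px; have [u [up pu lu]] := branch_play bp.
have ux n : s (mkseq u n) x.
  apply: (legal_sub ls (pu n)) => //; exact: level_legal (branch_level n bp).
have base : local_base s u x.
  apply: contrapT => nb; apply: (avW.2 u) => //; first by split=> //; exists x.
  move=> k; exists (size (p k.+1)); rewrite up.
  by have [_ _ _] := children_ext (bp.2 k).
move=> /base[n unO]; exists n; apply: subset_trans unO.
apply: (legal_sub ls (pu n)); exact: level_legal (branch_level n bp).
Qed.

Lemma branch_through x : (\bigcap_k level_cover k) x ->
  exists2 p, branch p & forall k, s (p k) x.
Proof.
move=> cx; have /choice[p pP] k : exists h, level k h /\ s h x.
  by have [h] := cx k Logic.I; exists h.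
exists p => [|k]; last by case: (pP k).
split=> [|k]; first by case: (pP 0%N).
have [[h lh ch] hx] := pP k.+1.
suff -> : p k = h by [].
have [lh' ph _ _] := children_ext ch.
apply: (level_disjoint (pP k).1 lh (pP k).2); exact: (legal_sub ls ph lh').
Qed.

Lemma branch_unique p q x n : branch p -> branch q -> s (p n) x -> s (q n) x ->
  agree p q n.+1.
Proof.
move=> bp bq px qx i; rewrite ltnS => ilen.
apply: (level_disjoint (branch_level i bp) (branch_level i bq) (x := x)).
  apply: (legal_sub ls (branch_prefix bp ilen)) px.
  exact: level_legal (branch_level n bp).
apply: (legal_sub ls (branch_prefix bq ilen)) qx.
exact: level_legal (branch_level n bq).
Qed.

Definition inhabited_branches : set (nat -> seq (set X)) :=
  [set p | branch p /\ exists x, forall k, s (p k) x].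

(** A point of the intersection lies in the answers along exactly one branch,
    by disjointness, and the answers along a branch share at most one point,
    since they form a local base at each. The branches through a position
    correspond to the points in the answer to it, and these answers form a base
    of the topology of the intersection. *)
Lemma homeomorphic_branches (R : realType) : hausdorff_space X ->
  homeomorphic (\bigcap_k level_cover k) (seq_space R inhabited_branches).
Proof.
move=> hX; set D := \bigcap_k _; set M := seq_space R _.
have /choice[c cP] (x : D) : exists p, branch p /\ forall k, s (p k) (\val x).
  have [p ? ?] := branch_through (set_mem (valP x)).
  by exists p.
have cA x : inhabited_branches (c x).
  by split; [case: (cP x)|exists (\val x); case: (cP x)].
pose f (x : D) : M := exist _ (c x) (cA x).
have /choice[g gP] (m : M) : exists x : D, forall k, s (sval m k) (\val x).
  case: m => p /= [bp [x px]].
  have Dx : D x by move=> k _; exists (p k) => //; apply: branch_level.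
  by exists (exist _ x (mem_set Dx)).
have Mbranch (m : M) : branch (sval m) by case: m => p [].
have fc (x : D) (m : M) n : s (sval m n) (\val x) -> agree (c x) (sval m) n.+1.
  by move=> mx; have [bc cx] := cP x; apply: branch_unique mx.
exists f, g; split.
- move=> x; apply: val_inj => /=; apply/esym/hX => U V Ux Vgx.
  have [bc cx] := cP x.
  have [k cU] := branch_local_base bc cx Ux.
  exists (\val (g (f x))); split; last exact: nbhs_singleton Vgx.
  by apply: cU; apply: (gP (f x)).
- case=> p pA; apply: eq_exist; apply/funext => n.
  exact: (fc (g (exist _ p pA)) (exist _ p pA) n (gP _ n) n (leqnn _)).
- move=> x O /nbhs_seqP[n fO].
  have [bc cx] := cP x.
  have nx : nbhs (\val x) (s (c x n)).
    apply: open_nbhs_nbhs; split => //; apply: legal_open => //.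
    exact: level_legal (branch_level n bc).
  have : nbhs x (\val @^-1` s (c x n)) by apply: (@initial_continuous D X \val).
  apply: filterS => y cy; apply: fO => i ilt /=; apply/esym.
  exact: (fc y (f x) n cy i (ltnW ilt)).
- move=> m O [U [[V oV VU] Ux] UO]; rewrite -VU in Ux UO.
  have [|k mV] := branch_local_base (Mbranch m) (gP m) (_ : nbhs _ V).
    by apply: open_nbhs_nbhs.
  apply/nbhs_seqP; exists k.+1 => q mq; apply: UO; apply: mV.
  by rewrite mq //; apply: gP.
Qed.

(** When alpha wins, every branch is inhabited, and being a branch is a closed
    condition. *)
Lemma complete_branches (R : realType) : winning_strategy s ->
  complete_uniform (seq_space R inhabited_branches).
Proof.
move=> [_ _ win]; apply: complete_seq_space => p clp.
have bp : branch p.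
  split; first by have [q [[q0 _] _] pq] := clp 1%N; rewrite pq.
  move=> k; have [q [[_ cq] _] pq] := clp k.+2.
  by rewrite !pq.
split=> //; have [u [up _ lu]] := branch_play bp.
have [x xu] := win u ((legal_playP s u).1 lu).
by exists x => k; rewrite -(up k); apply: (xu _ Logic.I).
Qed.

End Tree.

(** * Baire and Choquet spaces *)

Lemma baire_dense_Gdelta (X : topologicalType) (U : (set X)^nat) :
  baire_space X -> (forall n, open (U n) /\ dense (U n)) ->
  dense (\bigcap_n U n) /\ baire_space (\bigcap_n U n).
Proof.
move=> bX oU; have dD := bX U oU; split=> //; set D := \bigcap_n U n in dD *.
move=> F oF O O0 [V oV VO].
have /choice[G GF] n : exists G : set X, open G /\ \val @^-1` G = F n.
  by have [[G oG GF] _] := oF n; exists G.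
have [||x [Vx Hx]] := bX (fun n => G n `&` U n) _ V _ oV.
- move=> n; split; first by apply: openI; [case: (GF n)|case: (oU n)].
  move=> N N0 oN; have [x [Nx Dx]] := dD N N0 oN.
  have [||y [Ny Fy]] := (oF n).2 (\val @^-1` N).
  + by exists (exist _ x (mem_set Dx)).
  + by exists N.
  exists (\val y); split => //; split.
    by have [_ GE] := GF n; rewrite -GE in Fy.
  exact: (set_mem (valP y) n Logic.I).
- by case: O0 => x; rewrite -VO => Vx; exists (\val x).
have Dx : D x by move=> n _; case: (Hx n Logic.I).
exists (exist _ x (mem_set Dx)); split; first by rewrite -VO.
by move=> n _; have [_ <-] := GF n; case: (Hx n Logic.I).
Qed.

Lemma dense_baire (X : topologicalType) (D : set X) :
  dense D -> baire_space D -> baire_space X.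
Proof.
move=> dD bD F oF O O0 oO.
have [|||x [Ox Fx]] := bD (fun n => \val @^-1` F n) _ (\val @^-1` O).
- move=> n; split; first by exists (F n) => //; case: (oF n).
  move=> N [x Nx] [V oV VN].
  have [||y [[Vy Fy] Dy]] := dD (V `&` F n).
  + have [oFn dFn] := oF n; apply: dFn => //.
    by exists (\val x); rewrite -VN in Nx.
  + by apply: openI => //; case: (oF n).
  by exists (exist _ y (mem_set Dy)); split => //; rewrite -VN.
- have [y [Oy Dy]] := dD O O0 oO.
  by exists (exist _ y (mem_set Dy)).
- by exists O.
by exists (\val x); split => // n _; apply: Fx.
Qed.

Lemma winning_legal (X : topologicalType) (s : choquet_strategy X) :
  winning_strategy s -> legal_strategy s.
Proof. by move=> [s0 ls _]; split. Qed.

(** Beta's n-th move is alpha's last move cut down to the n-th dense open set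
    and to the given open set; alpha's winning strategy then yields a common
    point. *)
Lemma choquet_baire (X : topologicalType) : choquet_space X -> baire_space X.
Proof.
move=> [s ws] F oF O O0 oO; have ls := winning_legal ws; have [_ _ win] := ws.
pose next h := s h `&` (F (size h) `&` O).
pose hist := fix hist n :=
  if n is n'.+1 then rcons (hist n') (next (hist n')) else [::].
pose V n := next (hist n).
have histE n : mkseq V n = hist n.
  by elim: n => // n IHn; rewrite mkseqS IHn.
have next0 n : legal s (mkseq V n) -> (s (mkseq V n) `&` O) !=set0 ->
    legal s (mkseq V n.+1).
  move=> lh sO; rewrite mkseqS; apply/legal_rconsP.
  have [oFn dFn] := oF (size (hist n)).
  have oV : open (s (mkseq V n) `&` O) by apply: openI => //; apply: legal_open.
  rewrite histE in lh sO oV *; split => //.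
  - by rewrite /V /next setICA; apply: openI.
  - by rewrite /V /next setICA setIC; apply: dFn.
  - exact: subIsetl.
have lV : forall n, legal s (mkseq V n) /\ (s (mkseq V n) `&` O) !=set0.
  elim=> [|n [lh sO]]; first by rewrite /= ls.1 setTI; split.
  have lh' := next0 n lh sO; split=> //.
  rewrite mkseqS in lh' *; have [_ [x sx] sub] := legal_answer ls lh'.
  by exists x; split => //; have [_ []] := sub x sx.
have [x xs] := win V ((legal_playP s V).1 (fun n => (lV n).1)).
have xV n : V n x.
  have lh' := (lV n.+1).1; rewrite mkseqS in lh'.
  have [_ _] := legal_answer ls lh'; apply.
  by rewrite -mkseqS; apply: (xs n.+1 Logic.I).
exists x; split=> [|n _]; first by have [_ []] := xV 0%N.
have [_ [+ _]] := xV n; by rewrite -(histE n) size_mkseq.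
Qed.

(** Alpha answers [V n] with an open set whose closure lies in [V n] and whose
    trace on [D] sits in a ball of radius [1 / (n + 1)]. The traces generate a
    Cauchy filter, and its limit lies in the closures of alpha's moves. *)
Lemma dense_completely_metrizable_choquet (R : realType) (X : topologicalType)
    (D : set X) : @regular_space X -> dense D ->
  completely_metrizable_space R D -> choquet_space X.
Proof.
move=> regX dD [M [cM [f [g [fK gK cf cg]]]]].
have shrink (Vn : set X * nat) : exists U : set X,
    open Vn.1 -> Vn.1 !=set0 ->
    [/\ open U, U !=set0, closure U `<=` Vn.1 &
      exists m : M, forall d : D,
        U (\val d) -> ball m (Vn.2.+1%:R^-1 : R) (f d)].
  case: Vn => V n /=; have [oV|nV] := pselect (open V); last by exists set0.
  have [V0|nV] := pselect (V !=set0); last by exists set0.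
  have [x [Vx Dx]] := dD V V0 oV; pose d : D := exist _ x (mem_set Dx).
  have : nbhs d (f @^-1` ball (f d) (n.+1%:R^-1 : R)).
    by apply: cf; apply: nbhsx_ballx; rewrite invr_gt0.
  move=> [N' [[N oN NN'] Nd] N'f]; rewrite -NN' in Nd N'f.
  have /regX [K Kx KVN] : nbhs x (V `&` N).
    by apply: open_nbhs_nbhs; split; [apply: openI|split].
  exists K° => _ _; split.
  - exact: open_interior.
  - by exists x.
  - apply: subset_trans (closure_subset (@interior_subset _ _)) _.
    by move=> y /KVN[].
  - exists (f d) => e /interior_subset /subset_closure /KVN [_ Ne].
    exact: N'f.
have {shrink} /choice[S SP] := shrink.
pose s : choquet_strategy X := fun h =>
  if size h is n.+1 then S (nth set0 h n, n) else setT.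
have sE (V : (set X)^nat) n : alpha_move s V n.+1 = S (V n, n).
  by rewrite /alpha_move /s size_mkseq nth_mkseq.
exists s; split=> // [V n lV|V lV].
  have [oV V0 _] := lV n (leqnn n).
  have [oS S0 cS _] := SP (V n, n) oV V0.
  rewrite /legal_alpha sE; split => //.
  exact: subset_trans (@subset_closure _ _) cS.
pose U n := S (V n, n).
have UP n : [/\ open (U n), U n !=set0, closure (U n) `<=` V n &
    exists m : M, forall d : D, U n (\val d) -> ball m (n.+1%:R^-1 : R) (f d)].
  by have [oV V0 _] := lV n; apply: SP.
have Udecr m n : (m <= n)%N -> U n `<=` U m.
  elim: n => [|n IHn]; first by rewrite leqn0 => /eqP ->.
  rewrite leq_eqVlt => /orP[/eqP -> //|]; rewrite ltnS => /IHn.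
  apply: subset_trans; have [_ _ cU _] := UP n.+1; have [_ _] := lV n.+1.
  rewrite sE; apply: subset_trans.
  exact: subset_trans (@subset_closure _ _) cU.
have UD n : exists d : D, U n (\val d).
  have [oU U0 _ _] := UP n; have [x [Ux Dx]] := dD _ U0 oU.
  by exists (exist _ x (mem_set Dx)).
pose F : set_system M :=
  [set A | exists n, forall d : D, U n (\val d) -> A (f d)].
have PF : ProperFilter F.
  split; first by move=> [n An]; have [d /An] := UD n.
  split.
  - by exists 0%N.
  - move=> A B [m Am] [n Bn]; exists (maxn m n) => d Ud.
    by split; [apply: Am|apply: Bn]; apply: Udecr Ud;
      rewrite ?leq_maxl ?leq_maxr.
  - by move=> A B AB [n An]; exists n => d /An /AB.
have [|m Fm] := cM F PF.
  apply: (cauchy_exP F) => e e0; pose n := Num.bound e^-1.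
  have [_ _ _ [m Um]] := UP n; exists m, n => d /Um; apply: le_ball.
  apply: ltW; rewrite invf_plt ?posrE //.
  apply: lt_trans (archi_boundP _) _; first by rewrite invr_ge0 ltW.
  by rewrite ltr_nat.
exists (\val (g m)).
have mU n : closure (U n) (\val (g m)).
  move=> N /(@initial_continuous D X \val (g m)) /cg /Fm [k Uk].
  have [d Ud] := UD (maxn k n); exists (\val d); split.
    by apply: Udecr Ud; rewrite leq_maxr.
  have := Uk d; rewrite /= fK; apply; apply: Udecr Ud; rewrite leq_maxl //.
have mV n : V n (\val (g m)) by have [_ _ + _] := UP n; apply.
by move=> n _; have [_ _] := lV n; apply.
Qed.

(** * The dense metrizable subspace *)

Lemma legal_strategy_last (X : topologicalType) :
  legal_strategy (fun h : seq (set X) => last setT h).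
Proof.
split=> // V n lV; have [oV V0 _] := lV n (leqnn n).
by rewrite /legal_alpha /alpha_move mkseqS last_rcons; split.
Qed.

Lemma baire_homeomorphic_branches (R : realType) (X : topologicalType)
    (s : choquet_strategy X) : legal_strategy s -> piotrowski_space X ->
  @regular_space X -> hausdorff_space X -> baire_space X ->
  exists D : set X, [/\ dense D, baire_space D & exists M : metricType R,
    (winning_strategy s -> complete_uniform M) /\ homeomorphic D M].
Proof.
move=> ls pX rX hX bX; have [W avW] := piotrowski_avoidable_nil R ls pX rX.
have [|dD bD] := baire_dense_Gdelta (U := level_cover s W) bX.
  by move=> k; split; [apply: level_cover_open|apply: level_cover_dense].
exists (\bigcap_k level_cover s W k); split => //.
exists (seq_space R (inhabited_branches s W)); split.
  exact: complete_branches.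
exact: homeomorphic_branches.
Qed.

Theorem corollary7p4 (R : realType) (X : topologicalType)
  (pX : piotrowski_space X) (tX : tychonoff_space X) :
  (baire_space X <->
     exists D : set X, [/\ dense D, metrizable_space R D & baire_space D]) /\
  (choquet_space X <->
     exists D : set X, dense D /\ completely_metrizable_space R D).
Proof.
case: tX => crX hX; have rX := @completely_regular_regular R X crX.
split; split.
- move=> bX.
  have [D [dD bD [M [_ hM]]]] :=
    baire_homeomorphic_branches R (@legal_strategy_last X) pX rX hX bX.
  by exists D; split => //; exists M.
- by move=> [D [dD _ bD]]; apply: dense_baire bD.
- move=> cX; have [s ws] := cX.
  have [D [dD _ [M [cM hM]]]] := baire_homeomorphic_branches R
    (winning_legal ws) pX rX hX (choquet_baire cX).
  by exists D; split => //; exists M; split => //; apply: cM.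
- by move=> [D [dD cD]]; apply: dense_completely_metrizable_choquet cD.
Qed.
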